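(* Let $C=\mathbb{R}^n$, and let $f,g,\phi:\mathbb{R}^n\to(-\infty,+\infty]$ and $\Psi=f+g$ satisfy Assumptions (A), (B), (C), (D), (E) listed in the context. Let $\{\bm{x}^k\}_{k=0}^\infty$ be a sequence generated by the algorithm ABPG (described in the context) for solving $\min_{\bm{x}\in\mathbb{R}^n}\Psi(\bm{x})$, with search directions $\{\bm{d}^k\}_{k=0}^\infty$. Then the following statements hold: (i) The sequence $\{\bm{x}^k\}_{k=0}^\infty$ is bounded. (ii) $\lim_{k\to\infty}\|\bm{d}^k\|=0$. (iii) Any accumulation point $\tilde{\bm{x}}$ of $\{\bm{x}^k\}_{k=0}^\infty$ is a stationary point of the problem, i.e., $\bm{0}\in\partial\Psi(\tilde{\bm{x}})$.
   Context: Problem: minimize $\Psi(\bm{x}):=f(\bm{x})+g(\bm{x})$ over $\bm{x}\in\operatorname{cl}C$, where $C\subset\mathbb{R}^n$ is a nonempty open convex set; in this statement $C=\mathbb{R}^n$. Kernel generating distances: $\mathcal{G}(C)$ is the class of functions $\phi:\mathbb{R}^n\to(-\infty,+\infty]$ that are proper, lower semicontinuous and convex, with $\operatorname{dom}\phi\subset\operatorname{cl}C$, $\operatorname{dom}\partial\phi=C$, and $\phi$ is $\mathcal{C}^1$ on $\operatorname{int}\operatorname{dom}\phi=C$. $L$-smooth adaptable ($L$-smad): for $\phi\in\mathcal{G}(C)$ and $f:\mathbb{R}^n\to(-\infty,+\infty]$ proper and lower semicontinuous with $\operatorname{dom}\phi\subset\operatorname{dom}f$ and $f$ of class $\mathcal{C}^1$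 on $C$, the pair $(f,\phi)$ is $L$-smad on $C$, with $L>0$, if $L\phi-f$ and $L\phi+f$ are convex on $C$. Assumption (A): (i) $\phi\in\mathcal{G}(C)$ with $\operatorname{cl}C=\operatorname{cl}\operatorname{dom}\phi$ is $\mathcal{C}^2$ on $C=\operatorname{int}\operatorname{dom}\phi$. (ii) $f:\mathbb{R}^n\to(-\infty,+\infty]$ is proper and lower semicontinuous with $\operatorname{dom}\phi\subset\operatorname{dom}f$, and is $\mathcal{C}^1$ on $C$. (iii) $g:\mathbb{R}^n\to(-\infty,+\infty]$ is proper and convex with $\operatorname{dom}g\cap C\neq\emptyset$. (iv) $\Psi^*:=\inf_{\bm{x}\in\operatorname{cl}C}\Psi(\bm{x})>-\infty$. (v) For any $\bm{x}\in\operatorname{int}\operatorname{dom}\phi$ and $\lambda>0$, the function $\bm{u}\mapsto\lambda g(\bm{u})+\frac12\langle\nabla^2\phi(\bm{x})(\bm{u}-\bm{x}),\bm{u}-\bm{x}\rangle$ is supercoercive: its value divided by $\|\bm{u}\|$ tends to $\infty$ as $\|\bm{u}\|\to\infty$. Assumption (B): for any $\bm{x}\in C$ and $\lambda>0$, $\tilde{\mathcal{T}}_\lambda(\bm{x})\subset C$, where $\tilde{\mathcal{T}}_\lambda(\bm{x}):=\operatorname{argmin}_{\bm{u}\in\operatorname{cl}C}\{\langle\nabla f(\bm{x}),\bm{u}-\bm{x}\rangle+g(\bm{u})+\frac{1}{2\lambda}\langle\nabla^2\phi(\bm{x})(\bm{u}-\bm{x}),\bm{u}-\bm{x}\rangle\}$.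 Assumption (C): the pair $(f,\phi)$ is $L$-smad on $C$ for some $L>0$. Assumption (D): $\phi$ is $\sigma$-strongly convex on $C$ for some $\sigma>0$. Assumption (E): (i) $\nabla f$ and $\nabla\phi$ are Lipschitz continuous on any bounded subset of $\mathbb{R}^n$; (ii) $\Psi$ is level-bounded, i.e., for every $r\in\mathbb{R}$ the set $\{\bm{x}\in\mathbb{R}^n\mid\Psi(\bm{x})\le r\}$ is bounded. Algorithm ABPG: choose $\bm{x}^0\in\operatorname{int}\operatorname{dom}\phi$, $\eta\in(0,1)$, $\alpha\in(0,1)$, $\lambda>0$. For $k=0,1,2,\dots$: compute $\bm{d}^k=\operatorname{argmin}_{\bm{d}:\,\bm{x}^k+\bm{d}\in\operatorname{cl}C}\{\langle\nabla f(\bm{x}^k),\bm{d}\rangle+g(\bm{x}^k+\bm{d})+\frac{1}{2\lambda}\langle\nabla^2\phi(\bm{x}^k)\bm{d},\bm{d}\rangle\}$; set $t_k=1$, and while $\Psi(\bm{x}^k+t_k\bm{d}^k)>\Psi(\bm{x}^k)+\alpha t_k(\langle\nabla f(\bm{x}^k),\bm{d}^k\rangle+g(\bm{x}^k+\bm{d}^k)-g(\bm{x}^k))$ replace $t_k$ by $\eta t_k$; then set $\bm{x}^{k+1}=\bm{x}^k+t_k\bm{d}^k$. $\partial$ denotes the limiting subdifferential: for proper lower semicontinuous $h$, $\hat\partial h(\bm{x})=\{\bm{\xi}\mid\liminf_{\bm{y}\to\bm{x},\bm{y}\ne\bm{x}}\frac{h(\bm{y})-h(\bm{x})-\langle\bm{\xi},\bm{y}-\bm{x}\rangle}{\|\bm{x}-\bm{y}\|}\ge0\}$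 for $\bm{x}\in\operatorname{dom}h$ (empty otherwise), and $\partial h(\bm{x})$ is the set of limits $\bm{\xi}$ of sequences $\bm{\xi}^k\in\hat\partial h(\bm{y}^k)$ with $\bm{y}^k\to\bm{x}$, $h(\bm{y}^k)\to h(\bm{x})$. It coincides with the usual convex subdifferential for convex functions.
   Formalization: Part (iii) additionally assumes that Ψ = f + g is lower semicontinuous, which the definition of the limiting subdifferential requires; Assumption (A) only asks g to be proper and convex, and (iii) fails without it. Parts (i) and (ii) are unaffected. *)

(* Defs.v *)
From HB Require Import structures.
From mathcomp Require Import all_boot all_order all_algebra.
From mathcomp Require Import all_classical all_reals all_analysis.
Set Implicit Arguments.
Unset Strict Implicit.
Unset Printing Implicit Defensive.
Import Order.TTheory GRing.Theory Num.Theory.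
Import numFieldNormedType.Exports.

Local Open Scope classical_set_scope.
Local Open Scope ring_scope.

(** Points of R^n are row vectors ['rV[R]_n].
    Functions R^n -> (-oo, +oo] are functions into [\bar R] that satisfy [proper_fun].
    The norm that the library puts on ['rV[R]_n] is the max norm: wherever a
    norm or an inner product is written explicitly, the Euclidean [enorm] and
    [dot] below are used. The library's topology, [bounded_set] and
    [lipschitz] are kept, since they do not depend on the choice of a norm
    on R^n. *)

Section euclidean.
Context {R : realType} {n : nat}.
Implicit Types u v x : 'rV[R]_n.

Definition dot u v : R := \sum_i u ord0 i * v ord0 i.

Definition enorm u : R := Num.sqrt (dot u u).

Definition grad (F : 'rV[R]_n -> R) x : 'rV[R]_n :=
  \row_i 'D_(delta_mx ord0 i) F x.

(** Row-vector convention: [v *m hess F x] is the derivative of [grad F]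
    at [x] in the direction [v]. *)
Definition hess (F : 'rV[R]_n -> R) x : 'M[R]_n := 'J (grad F) x.

End euclidean.

Section extended_functions.
Context {R : realType} {n : nat}.
Implicit Types (h : 'rV[R]_n -> \bar R) (C D : set 'rV[R]_n).

Local Open Scope ereal_scope.

Definition edom h : set 'rV[R]_n := [set x | h x < +oo].

Definition proper_fun h := (forall x, -oo < h x) /\ edom h !=set0.

(** Used only for [h] that never takes the value -oo on [C], so that the
    right-hand side is never of the form +oo - oo; [0 * +oo = 0] in the
    library, so the cases [t = 0] and [t = 1] are trivially satisfied. *)
Definition econvex_on C h := forall x y (t : R), C x -> C y ->
  (0 <= t <= 1)%R ->
  h (t *: x + (1 - t) *: y)%R <= t%:E * h x + (1 - t)%:E * h y.

Definition strongly_convex_on C (sigma : R) h :=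
  econvex_on C (fun x => h x - (sigma / 2 * dot x x)%:E).

Definition egrad h : 'rV[R]_n -> 'rV[R]_n := grad (fine \o h).

(** The quadratic form <nabla^2 h(x) d, d>. *)
Definition ehess_form h (x d : 'rV[R]_n) : R :=
  dot (d *m hess (fine \o h) x) d.

(** The sets [C] below are open. *)
Definition C1_on C h := forall x, C x ->
  [/\ h x \is a fin_num, differentiable (fine \o h) x
    & {for x, continuous (egrad h)}].

Definition C2_on C h := C1_on C h /\ forall x, C x ->
  differentiable (egrad h) x /\ {for x, continuous (hess (fine \o h))}.

Definition argmin D h : set 'rV[R]_n :=
  [set u | D u /\ forall v, D v -> h u <= h v].

Definition supercoercive h := forall M : R, exists r : R,
  forall u, (r < enorm u)%R -> M%:E <= h u * ((enorm u)^-1)%:E.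

Definition level_bounded h :=
  forall r : R, bounded_set [set x | h x <= r%:E].

Definition frechet_subdiff h x : set 'rV[R]_n := [set xi |
  edom h x /\
  0 <= limf_einf (fun y =>
         (h y - h x - (dot xi (y - x))%:E) * ((enorm (x - y))^-1)%:E) x^'].

(** This is the limiting subdifferential only for proper lower semicontinuous
    [h]; as usual, it is empty outside the domain. *)
Definition limiting_subdiff h x : set 'rV[R]_n := [set xi |
  edom h x /\
  exists y v : nat -> 'rV[R]_n,
    [/\ forall k, frechet_subdiff h (y k) (v k),
        y @ \oo --> x, (h \o y) @ \oo --> h x & v @ \oo --> xi]].

End extended_functions.

(** [C] stands for a nonempty open convex set. *)
Section problem.
Context {R : realType} {n : nat}.
Variables (C : set 'rV[R]_n) (f g phi : 'rV[R]_n -> \bar R).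

Local Open Scope ereal_scope.

(** The class G(C) of kernel generating distances. *)
Definition kernel_generating_distance :=
  [/\ proper_fun phi, lower_semicontinuous phi & econvex_on setT phi] /\
  [/\ edom phi `<=` closure C,
      [set x | limiting_subdiff phi x !=set0] = C,
      interior (edom phi) = C
    & C1_on C phi].

Definition smooth_part :=
  [/\ proper_fun f, lower_semicontinuous f, edom phi `<=` edom f & C1_on C f].

Definition smad (L : R) :=
  [/\ kernel_generating_distance, smooth_part, (0 < L)%R,
      econvex_on C (fun x => L%:E * phi x - f x)
    & econvex_on C (fun x => L%:E * phi x + f x)].

Record assumptionA : Prop := AssumptionA {
  A_kernel : [/\ kernel_generating_distance,
                 closure C = closure (edom phi) & C2_on C phi];
  A_smooth : smooth_part;
  A_convex : [/\ proper_fun g, econvex_on setT g & edom g `&` C !=set0];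
  A_inf : -oo < ereal_inf ((f \+ g) @` closure C);
  A_supercoercive : forall x (lambda : R), interior (edom phi) x ->
    (0 < lambda)%R ->
    supercoercive (fun u =>
      lambda%:E * g u + (2^-1 * ehess_form phi x (u - x))%:E) }.

(** The argmin set T~_lambda(x). *)
Definition prox_step (lambda : R) (x : 'rV[R]_n) : set 'rV[R]_n :=
  argmin (closure C) (fun u =>
    (dot (egrad f x) (u - x))%:E + g u
    + ((2 * lambda)^-1 * ehess_form phi x (u - x))%:E).

Definition assumptionB := forall x (lambda : R), C x -> (0 < lambda)%R ->
  prox_step lambda x `<=` C.

Definition assumptionC := exists L : R, smad L.

Definition assumptionD :=
  exists2 sigma : R, (0 < sigma)%R & strongly_convex_on C sigma phi.

Record assumptionE : Prop := AssumptionE {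
  E_lipschitz : forall B : set 'rV[R]_n, bounded_set B ->
    [lipschitz egrad f x | x in B] /\ [lipschitz egrad phi x | x in B];
  E_level : level_bounded (f \+ g) }.

Definition search_direction (lambda : R) (x : 'rV[R]_n) : set 'rV[R]_n :=
  argmin [set d | closure C (x + d)%R] (fun d =>
    (dot (egrad f x) d)%:E + g (x + d)%R
    + ((2 * lambda)^-1 * ehess_form phi x d)%:E).

(** The condition under which the while loop continues. The scope [%dE]
    selects the convention +oo - oo = +oo, which matters only at a starting
    point outside dom g: there the right-hand side is +oo and the unit step
    is accepted. *)
Definition backtrack (alpha : R) (x d : 'rV[R]_n) (t : R) : bool :=
  ((f x + g x)%E
   + (alpha * t)%:E * ((dot (egrad f x) d)%:E + g (x + d)%R - g x))%dE
  < (f (x + t *: d)%R + g (x + t *: d)%R)%E.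

(** [x] and [d] are the iterates and directions of a run of the algorithm;
    [eta ^+ j] is the step size t_k, the first one leaving the loop. *)
Record ABPG (eta alpha lambda : R) (x d : nat -> 'rV[R]_n) : Prop := MkABPG {
  ABPG_eta : (0 < eta < 1)%R;
  ABPG_alpha : (0 < alpha < 1)%R;
  ABPG_lambda : (0 < lambda)%R;
  ABPG_init : interior (edom phi) (x 0%N);
  ABPG_direction : forall k, search_direction lambda (x k) (d k);
  ABPG_step : forall k, exists j : nat,
    [/\ forall i, (i < j)%N -> backtrack alpha (x k) (d k) (eta ^+ i)%R,
        ~~ backtrack alpha (x k) (d k) (eta ^+ j)%R
      & x k.+1 = (x k + eta ^+ j *: d k)%R] }.

End problem.

(* Main.v *)
(** Testing the direction subproblem at 0 shows that the first-order decrease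
    Delta_k = <grad f(x^k), d^k> + g(x^k + d^k) - g(x^k) satisfies
    Delta_k <= - c |d^k|^2, since the Hessian of phi is bounded below by sigma.
    Hence Psi(x^k) decreases from k = 1 on and the iterates stay in a level set
    of Psi, which is bounded.  A rejected step t = t_k / eta lands at
    x^k + eta^-1 (x^{k+1} - x^k), hence in a fixed ball on which grad f is
    Lipschitz; the Taylor bound on that ball then bounds t_k away from 0, so
    |d^k|^2 is dominated by the decrease of Psi and tends to 0.
    For stationarity put u^k = x^k + d^k.  Optimality of d^k yields a
    subgradient v^k of g at u^k, and grad f(u^k) + v^k is a Frechet subgradient
    of Psi at u^k; it tends to 0 along x^k -> xt.  The convergence
    Psi(u^k) -> Psi(xt) follows from lower semicontinuity and from the
    subgradient inequality of g at u^k tested at xt. *)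
Require Import Defs.
From HB Require Import structures.
From mathcomp Require Import all_boot all_order all_algebra.
From mathcomp Require Import all_classical all_reals all_analysis.
From mathcomp Require Import ring lra.
Set Implicit Arguments.
Unset Strict Implicit.
Unset Printing Implicit Defensive.
Import Order.TTheory GRing.Theory Num.Theory.
Import numFieldNormedType.Exports.
Local Open Scope classical_set_scope.
Local Open Scope ring_scope.

(** * Inner product, max norm and derivatives along lines *)

Section euclidean_theory.
Context {R : realType} {n : nat}.
Implicit Types (u v w x : 'rV[R]_n) (F : 'rV[R]_n -> R) (a : R).

Lemma dotC u v : dot u v = dot v u.
Proof. by apply: eq_bigr => i _; rewrite mulrC. Qed.

Lemma dotDl u v w : dot (u + v) w = dot u w + dot v w.
Proof. by rewrite -big_split; apply: eq_bigr => i _; rewrite mxE mulrDl. Qed.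

Lemma dotZl a u v : dot (a *: u) v = a * dot u v.
Proof. by rewrite /dot mulr_sumr; apply: eq_bigr => i _; rewrite mxE mulrA. Qed.

Lemma dotDr u v w : dot w (u + v) = dot w u + dot w v.
Proof. by rewrite !(dotC w) dotDl. Qed.

Lemma dotZr a u v : dot u (a *: v) = a * dot u v.
Proof. by rewrite !(dotC u) dotZl. Qed.

Lemma dotNl u v : dot (- u) v = - dot u v.
Proof. by rewrite -scaleN1r dotZl mulN1r. Qed.

Lemma dotNr u v : dot u (- v) = - dot u v.
Proof. by rewrite !(dotC u) dotNl. Qed.

Lemma dotBl u v w : dot (u - v) w = dot u w - dot v w.
Proof. by rewrite dotDl dotNl. Qed.

Lemma dot0r u : dot u 0 = 0.
Proof. by rewrite -(scale0r 0) dotZr mul0r. Qed.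

Lemma dot_trmx (M : 'M[R]_n) u v : dot (u *m M) v = dot (v *m M^T) u.
Proof.
rewrite /dot; under eq_bigr do rewrite mxE mulr_suml.
under [RHS]eq_bigr do rewrite mxE mulr_suml.
rewrite exchange_big; apply: eq_bigr => i _; apply: eq_bigr => j _.
by rewrite mxE; ring.
Qed.

Lemma coord_le_norm m (M : 'M[R]_(m, n)) i j : `|M i j| <= `|M|.
Proof.
rewrite [leRHS]/Num.norm /= mx_normrE.
by apply/bigmax_geP; right; exists (i, j).
Qed.

Lemma norm_le_coord m (M : 'M[R]_(m, n)) a : 0 <= a ->
  (forall i j, `|M i j| <= a) -> `|M| <= a.
Proof.
move=> a0 h; rewrite [leLHS]/Num.norm /= mx_normrE.
by apply/bigmax_leP; split => // -[i j] _; exact: h.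
Qed.

Lemma dot_ge0 u : 0 <= dot u u.
Proof. by apply: sumr_ge0 => i _; rewrite -expr2 sqr_ge0. Qed.

Lemma norm_le_enorm u : `|u| <= enorm u.
Proof.
apply: norm_le_coord => [|i j]; first exact: sqrtr_ge0.
rewrite ord1 -sqrtr_sqr; apply: ler_wsqrtr; rewrite /dot (bigD1 j)//= -expr2.
by rewrite lerDl sumr_ge0// => k _; rewrite -expr2 sqr_ge0.
Qed.

Lemma sqr_norm_le_dot u : `|u| ^+ 2 <= dot u u.
Proof.
rewrite -[leRHS]sqr_sqrtr ?dot_ge0// ler_pXn2r ?nnegrE ?sqrtr_ge0//.
exact: norm_le_enorm.
Qed.

(** Stands in for Cauchy-Schwarz in the max norm: each of the [n] coordinate products is at most
    [|u| * |v|]. This is the origin of the factors [n%:R] in the later constants. *)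
Lemma norm_dot_le u v : `|dot u v| <= n%:R * (`|u| * `|v|).
Proof.
apply: le_trans (ler_norm_sum _ _ _) _.
have -> : n%:R * (`|u| * `|v|) = \sum_(i < n) (`|u| * `|v|).
  by rewrite sumr_const card_ord mulr_natl.
by apply: ler_sum => i _; rewrite normrM ler_pM// coord_le_norm.
Qed.

Lemma norm_mulmx_le u (M : 'M[R]_n) : `|u *m M| <= n%:R * (`|u| * `|M|).
Proof.
apply: norm_le_coord => [|i j]; first by rewrite !mulr_ge0.
rewrite ord1 mxE; apply: le_trans (ler_norm_sum _ _ _) _.
have -> : n%:R * (`|u| * `|M|) = \sum_(k < n) (`|u| * `|M|).
  by rewrite sumr_const card_ord mulr_natl.
by apply: ler_sum => k _; rewrite normrM ler_pM// coord_le_norm.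
Qed.

Lemma norm_trmx_le (M : 'M[R]_n) : `|M^T| <= `|M|.
Proof. by apply: norm_le_coord => // i j; rewrite mxE coord_le_norm. Qed.

Lemma derive_dot_grad F x v : differentiable F x -> 'D_v F x = dot (grad F x) v.
Proof.
move=> dF; rewrite deriveE// [in LHS](row_sum_delta v) linear_sum.
by apply: eq_bigr => i _; rewrite linearZ/= mxE deriveE// mulrC.
Qed.

(** The difference quotient of the restriction to the line at [a] is, term by term, that of [F] at
    [x + a *: v] in direction [v]. *)
Lemma is_derive_line F x v a : differentiable F (x + a *: v) ->
  is_derive a 1 (fun s => F (x + s *: v)) (dot (grad F (x + a *: v)) v).
Proof.
move=> dF; have e : (fun h : R => h^-1 *:
    (((fun s => F (x + s *: v)) \o shift a) (h *: 1) - F (x + a *: v))) =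
    (fun h => h^-1 *: ((F \o shift (x + a *: v)) (h *: v) - F (x + a *: v))).
  by apply/funext => h /=; rewrite [h *: 1]mulr1 scalerDl addrCA.
have dvF : derivable F (x + a *: v) v by exact: diff_derivable.
split; first by rewrite /derivable e; exact: dvF.
by rewrite -derive_dot_grad// /derive e.
Qed.

Lemma cvg_line F x v : differentiable F x ->
  (fun h => h^-1 * (F (x + h *: v) - F x)) @ 0^'+ --> dot (grad F x) v.
Proof.
move=> dF; have dvF : derivable F x v by exact: diff_derivable.
rewrite -derive_dot_grad//; apply: cvg_dnbhs_at_right.
have -> : (fun h : R => h^-1 * (F (x + h *: v) - F x)) =
    (fun h => h^-1 *: ((F \o shift x) (h *: v) - F x)).
  by apply/funext => h /=; rewrite (addrC x).
exact: dvF.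
Qed.

End euclidean_theory.

(** * Taylor bound and differential forms of strong convexity *)

Section first_order.
Context {R : realType} {n : nat}.
Implicit Types (u v w x y : 'rV[R]_n) (F : 'rV[R]_n -> R).

(** By the mean value theorem the increment is [dot (grad F y) w] for some [y] on the segment. The
    gradient is compared only between the segment and [x], so a Lipschitz constant valid on a ball
    is enough. *)
Lemma lipschitz_grad_taylor F x w M :
  (forall y, differentiable F y) ->
  (forall s, 0 <= s <= 1 -> `|grad F (x + s *: w) - grad F x| <= M * `|w|) ->
  `|F (x + w) - F x - dot (grad F x) w| <= n%:R * M * `|w| ^+ 2.
Proof.
move=> dF lipF.
have dl (s : R) : is_derive s 1 (fun s => F (x + s *: w))
    (dot (grad F (x + s *: w)) w) by exact: is_derive_line.
have [|s s01] := @MVT_segment R _ _ 0 1 ler01 (fun s _ => dl s).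
  by apply: derivable_within_continuous => s _; have [] := dl s.
rewrite scale1r scale0r addr0 subr0 mulr1 => ->; rewrite -dotBl.
apply: le_trans (norm_dot_le _ _) _; rewrite -mulrA ler_wpM2l// expr2 mulrA.
by rewrite ler_wpM2r// lipF.
Qed.

(** The chord inequality between [x] and [x + w] at parameter [h] bounds the difference quotient of
    [F] at [x]; then [h] tends to 0. *)
Lemma strong_convexity_grad F (sigma : R) x w : differentiable F x ->
  (forall y z t, 0 <= t <= 1 ->
    F (t *: y + (1 - t) *: z) -
      sigma / 2 * dot (t *: y + (1 - t) *: z) (t *: y + (1 - t) *: z) <=
    t * (F y - sigma / 2 * dot y y) + (1 - t) * (F z - sigma / 2 * dot z z)) ->
  F x + dot (grad F x) w + sigma / 2 * dot w w <= F (x + w).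
Proof.
move=> dF cF.
(* The chord inequality carries the quadratic term with the factor [1 - h], whose limit is kept in
   the form [1 - 0]. *)
suff : dot (grad F x) w <= F (x + w) - F x - sigma / 2 * dot w w * (1 - 0).
  by lra.
have cg : (fun h : R => F (x + w) - F x - sigma / 2 * dot w w * (1 - h))
    @ 0^'+ --> F (x + w) - F x - sigma / 2 * dot w w * (1 - 0).
  apply: cvg_at_right_filter; apply: cvgB; first exact: cvg_cst.
  by apply: cvgM; [exact: cvg_cst|apply: cvgB; [exact: cvg_cst|exact: cvg_id]].
apply: ler_cvg_to (@cvg_line _ _ F x w dF) cg _; near=> h.
have h0 : 0 < h by near: h; exact: nbhs_right_gt.
have h1 : h < 1 by near: h; exact: nbhs_right_lt.
rewrite ler_pdivrMl//.
have /(cF (x + w) x) : 0 <= h <= 1 by rewrite !ltW.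
have -> : h *: (x + w) + (1 - h) *: x = x + h *: w.
  by apply/rowP => i; rewrite !mxE; ring.
rewrite !(dotDl, dotDr, dotZl, dotZr) (dotC w x).
by move: (dot x x) (dot x w) (dot w w) (F _) (F _) (F _) => *; nra.
Unshelve. all: by end_near. Qed.

Lemma cvg_dotl T {G : set_system T} {FG : Filter G} (p : T -> 'rV[R]_n) u w :
  p @ G --> u -> (fun t => dot (p t) w) @ G --> dot u w.
Proof.
move=> pu; rewrite /dot; apply: cvg_big => [|i _].
  by move=> z; exact: add_continuous.
have cu := continuous_cvg _ (@coord_continuous R 1 n ord0 i u) pu.
by apply: cvgM; [exact: cu|exact: cvg_cst].
Qed.

Lemma cvg_mulmx0 (u : nat -> 'rV[R]_n) (H : nat -> 'M[R]_n) (H0 : 'M[R]_n) :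
  u @ \oo --> (0 : 'rV[R]_n) -> H @ \oo --> H0 ->
  (fun j => u j *m (H j + (H j)^T)) @ \oo --> (0 : 'rV[R]_n).
Proof.
move=> u0 Hc; apply: norm_cvg0.
have c0 : (fun j => n%:R * (`|u j| * (`|H j| + `|H j|))) @ \oo --> (0 : R).
  have -> : 0 = n%:R * (`|0 : 'rV[R]_n| * (`|H0| + `|H0|)) :> R.
    by rewrite normr0 mul0r mulr0.
  apply: cvgM; first exact: cvg_cst.
  by apply: cvgM; [exact: cvg_norm|apply: cvgD; exact: cvg_norm].
apply: (@squeeze_cvgr _ _ _ _ (cst 0) _ _ _ 0 _ c0); last exact: cvg_cst.
near=> j; rewrite normr_ge0/=; apply: le_trans (norm_mulmx_le _ _) _.
rewrite ler_wpM2l// ler_wpM2l//; apply: le_trans (ler_normD _ _) _.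
by rewrite lerD2l norm_trmx_le.
Unshelve. all: by end_near. Qed.

(** Adding the first-order inequalities at [x] and at [x + h *: w] gives strong monotonicity of the
    gradient; dividing by [h ^+ 2] and letting [h] tend to 0 yields the Hessian. *)
Lemma strong_convexity_hess F (sigma : R) x w :
  (forall y, differentiable F y) -> differentiable (grad F) x ->
  (forall y z t, 0 <= t <= 1 ->
    F (t *: y + (1 - t) *: z) -
      sigma / 2 * dot (t *: y + (1 - t) *: z) (t *: y + (1 - t) *: z) <=
    t * (F y - sigma / 2 * dot y y) + (1 - t) * (F z - sigma / 2 * dot z z)) ->
  sigma * dot w w <= dot (w *m hess F x) w.
Proof.
move=> dF dgF cF; rewrite -deriveEjacobian//.
have dwF : derivable (grad F) x w by exact: diff_derivable.
have cw := @cvg_dotl _ _ _ _ _ w (cvg_dnbhs_at_right dwF).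
apply: cvgr_to_ge (cw _) _; near=> h.
have h0 : 0 < h by near: h; exact: nbhs_right_gt.
rewrite dotZl ler_pdivlMl// dotBl /= (addrC _ x).
have h1 := strong_convexity_grad (h *: w) (dF x) cF.
have h2 := strong_convexity_grad (- (h *: w)) (dF (x + h *: w)) cF.
move: h1 h2; rewrite addrK !(dotNl, dotNr, dotZl, dotZr).
move: (F _) (F _) (dot (grad _ _) _) (dot (grad _ _) _) (dot w w).
move=> a b c e W p q.
rewrite -(ler_pM2l h0); nra.
Unshelve. all: by end_near. Qed.

End first_order.

(** * The direction subproblem and Frechet subgradients of a sum *)

Section nonsmooth.
Context {R : realType} {n : nat}.
Implicit Types (a d u v w x y : 'rV[R]_n) (H : 'M[R]_n).
Implicit Types f g : 'rV[R]_n -> \bar R.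

Lemma proper_fin_num g x : proper_fun g -> (g x < +oo)%E -> g x \is a fin_num.
Proof. by move=> [gNy _] gx; rewrite fin_real// gNy. Qed.

Lemma argmin_fin_num g a d x H (c : R) : proper_fun g ->
  (forall d', (dot a d)%:E + g (x + d)%R + (c * dot (d *m H) d)%:E <=
    (dot a d')%:E + g (x + d')%R + (c * dot (d' *m H) d')%:E)%E ->
  g (x + d) \is a fin_num.
Proof.
move=> gP dmin; apply: (proper_fin_num gP).
(* Comparison with the displacement from [x] to a point [z] of the domain of [g] makes the minimal
   value finite. *)
have [gNy [z gz]] := gP; have := dmin (z - x); rewrite (subrKC x z).
have /fineK <- := proper_fin_num gP gz.
by have := gNy (x + d); case: (g (x + d)) => //= r _; rewrite ltry.
Qed.

(** The gradient of [c * dot (d *m H) d] is written with [H + H^T], so that the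
    symmetry of the Hessian of phi (Schwarz's theorem) is never needed. *)
Lemma argmin_subgradient g a d x H (c : R) : proper_fun g ->
  econvex_on setT g ->
  (forall d', (dot a d)%:E + g (x + d)%R + (c * dot (d *m H) d)%:E <=
    (dot a d')%:E + g (x + d')%R + (c * dot (d' *m H) d')%:E)%E ->
  forall y, (g (x + d)%R +
    (dot (- (a + c *: (d *m (H + H^T)))) (y - (x + d)))%:E <= g y)%E.
Proof.
move=> gP gC dmin y.
have /fineK := argmin_fin_num gP dmin.
move: (fine _) => G gd.
have [gy|] := ltP (g y) +oo%E; last by rewrite leye_eq => /eqP ->; rewrite leey.
have /fineK := proper_fin_num gP gy; move: (fine _) => Gy ey.
have yE : y = x + d + (y - (x + d)) by rewrite subrKC.
move: (y - (x + d)) yE => w yE; rewrite -gd -ey -EFinD lee_fin.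
(* Minimality of [d] against [d + s *: w], with convexity of [g] on the segment from [x + d] to [y],
   divided by [s]. *)
have key (s : R) : 0 < s <= 1 ->
  0 <= dot a w + Gy - G + c * (dot (d *m H) w + dot (w *m H) d) +
      s * (c * dot (w *m H) w).
  move=> /andP[s0 s1].
  have s01 : 0 <= s <= 1 by rewrite ltW.
  have := gC y (x + d) s I I s01; rewrite -gd -ey -!EFinM -EFinD.
  have -> : s *: y + (1 - s) *: (x + d) = x + (d + s *: w).
    by rewrite yE; apply/rowP => i; rewrite !mxE; ring.
  move=> gle; have := dmin (d + s *: w).
  have gfin : g (x + (d + s *: w)) \is a fin_num.
    by apply: (proper_fin_num gP); apply: le_lt_trans gle _; rewrite ltry.
  move: gle; rewrite -(fineK gfin) -gd -!EFinD !lee_fin.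
  rewrite mulmxDl -scalemxAl !(dotDr, dotDl, dotZr, dotZl).
  move: (fine _) (dot _ _) (dot _ _) (dot _ _) (dot _ _) (dot _ _) (dot _ _) =>
    q A B C D E K h1 h2.
  rewrite -(pmulr_rge0 _ s0); nra.
(* The limit [s] to 0 done by hand: if [p] were negative, [s = 1] or [s = - p / 2 / q] would make
   [p + s * q] negative. *)
have lim0 (p q : R) : (forall s, 0 < s <= 1 -> 0 <= p + s * q) -> 0 <= p.
  move=> h; rewrite leNgt; apply/negP => p0.
  have [q0|q0] := leP q (- p / 2).
    by have := h 1; rewrite ltr01 lexx => /(_ isT); lra.
  have q1 : 0 < q by lra.
  have : 0 < - p / 2 / q <= 1.
    by rewrite divr_gt0 ?ler_pdivrMr//= ?mul1r ?ltW//; lra.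
  by move=> /h; rewrite divfK ?gt_eqF//; lra.
have := lim0 _ _ key.
rewrite mulmxDr !(dotNl, dotDl, dotZl) -(dot_trmx H w d).
by move: (dot _ _) (dot _ _) (dot _ _) => *; lra.
Qed.

Lemma argmin_descent g a d x H (c : R) : proper_fun g -> (g x < +oo)%E ->
  (forall d', (dot a d)%:E + g (x + d)%R + (c * dot (d *m H) d)%:E <=
    (dot a d')%:E + g (x + d')%R + (c * dot (d' *m H) d')%:E)%E ->
  dot a d + fine (g (x + d)) - fine (g x) <= - (c * dot (d *m H) d).
Proof.
move=> gP gx dmin; have /fineK gd := argmin_fin_num gP dmin.
have /fineK ex := proper_fin_num gP gx.
have := dmin 0; rewrite addr0 -gd -ex -!EFinD lee_fin mul0mx !dot0r /=.
lra.
Qed.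

(** The remainder of [f] at [u] is quadratic in the distance, so its quotient by the norm vanishes
    at [u], while the subgradient inequality makes the contribution of [g] nonnegative. *)
Lemma frechet_subdiff_sum f g u v M r : 0 < r ->
  (forall y, f y \is a fin_num) -> (forall y, differentiable (fine \o f) y) ->
  (forall y z, `|y| <= r -> `|z| <= r ->
     `|egrad f y - egrad f z| <= M * `|y - z|) ->
  `|u| < r -> g u \is a fin_num ->
  (forall y, g u + (dot v (y - u))%:E <= g y)%E ->
  frechet_subdiff (f \+ g)%E u (egrad f u + v).
Proof.
move=> r0 ffin df lipf ur gu subg; split.
  by rewrite /edom/= -(fineK (ffin u)) -(fineK gu) -EFinD ltry.
rewrite limf_einfE; apply/lee_addgt0Pr => e e0.
have M0 : 0 < `|M| + 1 by rewrite ltr_wpDl.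
have nM0 : 0 < n%:R * (`|M| + 1) + 1 by rewrite ltr_wpDl// mulr_ge0// ltW.
(* The first bound keeps the segment from [u] to [y] in the ball where the Lipschitz estimate holds;
   the second makes the quadratic remainder at most [e] times the norm. The added ones keep the
   constants positive for any sign of [M] and for [n = 0]. *)
pose del := Num.min (r - `|u|) (e / (n%:R * (`|M| + 1) + 1)).
have del0 : 0 < del by rewrite lt_min subr_gt0 ur divr_gt0.
set q := (fun y => _ * _)%E.
pose V := [set y | y != u /\ `|y - u| < del].
rewrite -leeBlDr// sub0e -EFinN.
(* The lower limit is a supremum of infima over deleted neighbourhoods, so the single set [V] with
   infimum at least [- e] suffices. *)
apply: le_trans (ereal_sup_ubound _); last first.
  exists V => //; apply: (iffRL (nbhs_ballP u [set y | y != u -> V y])).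
  exists del => //= y + yNu; rewrite -ball_normE/= => yu.
  by split => //; rewrite distrC.
apply: le_ereal_inf_tmp => _ [y [yNu yu] <-]; rewrite /q.
have wpos : 0 <= (enorm (u - y))^-1 by rewrite invr_ge0 sqrtr_ge0.
pose w := y - u.
have yE : y = u + w by rewrite /w subrKC.
have taylor : `|fine (f y) - fine (f u) - dot (egrad f u) w| <=
    n%:R * (`|M| + 1) * `|w| ^+ 2.
  rewrite yE; apply: (lipschitz_grad_taylor df) => s /andP[s0 s1].
  apply: le_trans (lipf _ _ _ _) _; last 1 first.
  - rewrite addrC addKr normrZ (ger0_norm s0).
    apply: (@le_trans _ _ (`|M| * (s * `|w|))).
      by rewrite ler_wpM2r ?ler_norm// mulr_ge0.
    by rewrite ler_pM ?mulr_ge0 ?lerDl ?ler_piMl.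
  - apply: le_trans (ler_normD _ _) _; rewrite normrZ (ger0_norm s0).
    have : `|w| < r - `|u| by move: yu; rewrite lt_min => /andP[].
    by have := normr_ge0 w; move: (`|w|) => p *; nra.
  - exact: ltW.
have lb : (((fine (f y) - fine (f u) - dot (egrad f u) w))%:E <=
    (f \+ g) y - (f \+ g) u - (dot (egrad f u + v) (y - u))%:E)%E.
  have := subg y; rewrite /= -(fineK (ffin y)) -(fineK (ffin u)) -(fineK gu).
  case: (g y) => [s| |]//=; last by rewrite ?leey.
  rewrite -!EFinD !lee_fin dotDl -/w; lra.
apply: le_trans (lee_wpmul2r _ lb); rewrite ?lee_fin//.
have wn : 0 < `|w| by rewrite normr_gt0 subr_eq0.
(* The quotient divides by the Euclidean norm, whereas the remainder is bounded in the max norm. *)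
have we : `|w| <= enorm (u - y).
  by rewrite -normrN opprB; exact: norm_le_enorm.
have e1 : n%:R * (`|M| + 1) * `|w| <= e.
  have : `|w| < e / (n%:R * (`|M| + 1) + 1).
    by move: yu; rewrite lt_min => /andP[].
  rewrite ltr_pdivlMr// => h; apply: le_trans (ltW h).
  by move: (n%:R * _) => K; lra.
have we0 : 0 < enorm (u - y) by apply: lt_le_trans we.
rewrite ler_pdivlMr//.
apply: le_trans (_ : - (n%:R * (`|M| + 1) * `|w| ^+ 2) <= _); last first.
  by move: taylor; rewrite ler_norml => /andP[].
rewrite mulNr lerN2 expr2 mulrA; by apply: ler_pM; rewrite ?mulr_ge0 ?addr_ge0.
Qed.

End nonsmooth.

(** * Backtracking and sufficient decrease *)

Section line_search.
Context {R : realType} {n : nat}.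
Implicit Types (d x y : 'rV[R]_n) (f g phi : 'rV[R]_n -> \bar R).

Lemma lipschitz_on_ball (G : 'rV[R]_n -> 'rV[R]_n) :
  (forall B : set 'rV[R]_n, bounded_set B -> [lipschitz G x | x in B]) ->
  forall r, exists2 M : R, 0 < M & forall y z, `|y| <= r -> `|z| <= r ->
    `|G y - G z| <= M * `|y - z|.
Proof.
move=> lipG r.
have /lipG/pinfty_ex_gt0[M M0 hM] : bounded_set [set y : 'rV[R]_n | `|y| <= r].
  exists r; split; first exact: num_real.
  by move=> s rs y /= yr; apply: le_trans yr (ltW rs).
by exists M => // y z yr zr; exact: (hM (y, z)).
Qed.

Lemma strongly_convex_ehess_form phi (sigma : R) x d :
  C2_on setT phi -> strongly_convex_on setT sigma phi ->
  sigma * dot d d <= ehess_form phi x d.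
Proof.
move=> [C1 C2] sc.
have pf y : phi y = (fine (phi y))%:E by have [/fineK] := C1 y I.
apply: strong_convexity_hess => [y||y z t t01].
- by have [] := C1 y I.
- by have [] := C2 x I.
have := sc y z t I I t01.
by rewrite (pf y) (pf z) (pf (_ + _)) -!EFinB -!EFinM -EFinD lee_fin.
Qed.

(** With Delta the first-order decrease, Taylor and convexity of [g] bound the change of Psi by [t]
    Delta plus [n%:R * M * t ^+ 2 * dot d d]. Rejection says that the change exceeds [alpha * t]
    Delta. Comparing the two and dividing by [t * dot d d] leaves a lower bound on [t]. *)
Lemma backtrack_step_lb f g (alpha c M r t : R) x d : alpha < 1 -> 0 < M ->
  (forall y, f y \is a fin_num) -> (forall y, differentiable (fine \o f) y) ->
  (forall y z, `|y| <= r -> `|z| <= r ->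
     `|egrad f y - egrad f z| <= M * `|y - z|) ->
  proper_fun g -> econvex_on setT g ->
  g x \is a fin_num -> g (x + d) \is a fin_num ->
  `|x| <= r -> `|x + t *: d| <= r -> 0 < t <= 1 ->
  dot (egrad f x) d + fine (g (x + d)) - fine (g x) <= - (c * dot d d) ->
  backtrack f g alpha x d t -> (1 - alpha) * c <= n%:R * M * t.
Proof.
move=> a1 M0 ffin df lipf gP gC gx gd xr tr /andP[t0 t1] desc.
have t01 : 0 <= t <= 1 by rewrite ltW.
have gt := gC (x + d) x t I I t01.
have ext : t *: (x + d) + (1 - t) *: x = x + t *: d.
  by apply/rowP => i; rewrite !mxE; ring.
rewrite ext -(fineK gx) -(fineK gd) -!EFinM -EFinD in gt.
have gtf : g (x + t *: d) \is a fin_num.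
  by apply: (proper_fin_num gP); apply: le_lt_trans gt _; rewrite ltry.
have taylor : `|fine (f (x + t *: d)) - fine (f x) - dot (egrad f x) (t *: d)|
    <= n%:R * M * `|t *: d| ^+ 2.
  apply: (lipschitz_grad_taylor df) => s /andP[s0 s1].
  apply: le_trans (lipf _ _ _ xr) _; last first.
    rewrite addrC addKr !normrZ (ger0_norm s0).
    by rewrite ler_wpM2l ?(ltW M0)// ler_piMl// mulr_ge0.
  (* A convex combination of two points of the ball stays in the ball. *)
  have -> : x + s *: (t *: d) = (1 - s) *: x + s *: (x + t *: d).
    by apply/rowP => i; rewrite !mxE; ring.
  apply: le_trans (ler_normD _ _) _.
  rewrite !normrZ (ger0_norm s0) ger0_norm ?subr_ge0//.
  by move: (`|x|) (`|_|) xr tr => p q *; nra.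
rewrite /backtrack -(fineK (ffin x)) -(fineK (ffin (x + t *: d))).
move: gt; rewrite -(fineK gx) -(fineK gd) -(fineK gtf) /= !lee_fin.
rewrite /dual_adde /= lte_fin => gt bt.
move: taylor; rewrite ler_norml normrZ (gtr0_norm t0) dotZr => /andP[_ taylor].
have dd := sqr_norm_le_dot d.
have nM : 0 <= n%:R * M by rewrite mulr_ge0// ltW.
move: (n%:R * M) nM taylor => K K0 taylor.
have e1 : (1 - alpha) * (t * c * dot d d) < K * t ^+ 2 * dot d d.
  have : K * (t * `|d|) ^+ 2 <= K * t ^+ 2 * dot d d.
    by rewrite exprMn mulrA ler_wpM2l// mulr_ge0// sqr_ge0.
  have : (1 - alpha) * (t * (c * dot d d)) <= (1 - alpha) *
      (t * - (dot (egrad f x) d + fine (g (x + d)) - fine (g x))).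
    rewrite ler_wpM2l ?subr_ge0 ?(ltW a1)// ler_wpM2l ?(ltW t0)//.
    by rewrite lerNr.
  move: taylor gt bt; rewrite /egrad/=; move: (grad _ _) => G.
  move: (K * _ ^+ 2) (dot _ _) (dot _ _) => ? ? ?.
  by move: (fine _) (fine _) (fine _) (fine _) (fine _) => *; lra.
(* The strict inequality [e1] rules out [d = 0]. *)
have D0 : 0 < dot d d.
  rewrite lt_neqAle dot_ge0 andbT eq_sym; apply: contraTneq e1 => ->.
  by rewrite !mulr0 ltxx.
have : t * dot d d * ((1 - alpha) * c) < t * dot d d * (K * t) by lra.
by rewrite ltr_pM2l ?mulr_gt0// => /ltW.
Qed.

(** A nonincreasing sequence bounded below converges, so its successive differences tend to 0, and
    these dominate [c * E k]. *)
Lemma sufficient_decrease_cvg0 (P E : nat -> R) (c m : R) : 0 < c ->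
  (forall k, 0 <= E k) -> (forall k, m <= P k) ->
  (forall k, P k.+1 <= P k - c * E k) -> E @ \oo --> (0 : R).
Proof.
move=> c0 E0 mP dec.
have ndP : nonincreasing_seq P.
  by apply/nonincreasing_seqP => k; have := dec k; have := E0 k; nra.
have /cvg_ex[l Pl] : cvgn P.
  apply: nonincreasing_is_cvgn => //.
  by exists m => _ [k _ <-].
have Pl' : [sequence P k.+1]_k @ \oo --> l by rewrite cvg_shiftS.
have dl : (fun k => c^-1 * (P k - P k.+1)) @ \oo --> (0 : R).
  rewrite -(mulr0 c^-1) -(subrr l); apply: cvgM; first exact: cvg_cst.
  exact: cvgB.
apply: (@squeeze_cvgr _ _ _ _ (cst 0) _ _ _ 0 _ dl); last exact: cvg_cst.
near=> k.
by rewrite E0/= ler_pdivlMl//; have := dec k; lra.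
Unshelve. all: by end_near. Qed.

End line_search.

(** * Descent and accumulation points of a run of the algorithm *)

Section abpg_run.
Context {R : realType} {n : nat} {f g phi : 'rV[R]_n -> \bar R}.
Context (hA : assumptionA [set: 'rV[R]_n] f g phi).
Context (hD : assumptionD [set: 'rV[R]_n] phi) (hE : assumptionE f g phi).
Context {eta alpha lambda : R} {x d : nat -> 'rV[R]_n}.
Context (hx : ABPG [set: 'rV[R]_n] f g phi eta alpha lambda x d).

(** The index starts at [k.+1] because [g (x 0)] may be [+oo], which [fine] would send to 0. *)
Let P k := fine (f (x k.+1)) + fine (g (x k.+1)).

Let descent_rate (c : R) := forall k,
  dot (egrad f (x k.+1)) (d k.+1) + fine (g (x k.+1 + d k.+1)) -
    fine (g (x k.+1)) <= - (c * dot (d k.+1) (d k.+1)).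

Lemma smooth_fin_num y : f y \is a fin_num.
Proof. by have [_ _ _ C1] := A_smooth hA; have [] := C1 y I. Qed.

Lemma smooth_differentiable y : differentiable (fine \o f) y.
Proof. by have [_ _ _ C1] := A_smooth hA; have [] := C1 y I. Qed.

Lemma search_direction_min k d' :
  ((dot (egrad f (x k)) (d k))%:E + g (x k + d k)%R +
     ((2 * lambda)^-1 * dot (d k *m hess (fine \o phi) (x k)) (d k))%:E <=
   (dot (egrad f (x k)) d')%:E + g (x k + d')%R +
     ((2 * lambda)^-1 * dot (d' *m hess (fine \o phi) (x k)) d')%:E)%E.
Proof. by have [_] := ABPG_direction hx k; apply; rewrite /= closureT. Qed.

(** The starting point may lie outside dom g: the test then compares with +oo,
    and the unit step leads into dom g. *)
Lemma iterate_succ_fin_num k : g (x k.+1) \is a fin_num.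
Proof.
have [gP gC _] := A_convex hA.
have gd := argmin_fin_num gP (@search_direction_min k).
have [/andP[e0 e1] [j [bt _ ->]]] := (ABPG_eta hx, ABPG_step hx k).
have [gx|] := ltP (g (x k)) +oo%E.
  have gxf := proper_fin_num gP gx; apply: (proper_fin_num gP).
  have t01 : 0 <= eta ^+ j <= 1 by rewrite exprn_ge0 ?exprn_ile1 ?ltW.
  have := gC (x k + d k) (x k) _ I I t01.
  have -> : eta ^+ j *: (x k + d k) + (1 - eta ^+ j) *: x k =
      x k + eta ^+ j *: d k.
    by apply/rowP => i; rewrite !mxE; ring.
  by move=> /le_lt_trans; apply; rewrite -(fineK gxf) -(fineK gd) ltry.
rewrite leye_eq => /eqP gx.
(* For positive [j] the unit step would have been rejected, which requires a value above [+oo]. *)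
case: j bt => [_|j /(_ 0%N isT)]; first by rewrite expr0 scale1r.
by rewrite /backtrack gx -(fineK (smooth_fin_num (x k))) /= ltNge leey.
Qed.

Lemma iterate_value k : (f (x k.+1) + g (x k.+1) = (P k)%:E)%E.
Proof.
by rewrite EFinD (fineK (smooth_fin_num _)) (fineK (iterate_succ_fin_num _)).
Qed.

Lemma search_direction_descent : exists2 c : R, 0 < c & descent_rate c.
Proof.
have [sigma s0 sc] := hD; have [_ _ C2] := A_kernel hA.
have [gP _ _] := A_convex hA; have l0 := ABPG_lambda hx.
have l20 : 0 < (2 * lambda)^-1 by rewrite invr_gt0 mulr_gt0.
(* The weight of the quadratic term in the subproblem times the lower bound on the Hessian. *)
exists ((2 * lambda)^-1 * sigma) => [|k]; first exact: mulr_gt0.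
have gx : (g (x k.+1) < +oo)%E.
  by rewrite -(fineK (iterate_succ_fin_num k)) ltry.
apply: le_trans (argmin_descent gP gx (@search_direction_min _)) _.
rewrite lerN2 -mulrA ler_pM2l//.
exact: (strongly_convex_ehess_form _ _ C2 sc).
Qed.

(** The final alternative records why [t] is not larger: it is the unit step, or the preceding trial
    [t / eta] was rejected. The lower bound on step sizes rests on it. *)
Lemma iterate_decrease (c : R) : descent_rate c -> forall k, exists2 t,
  [/\ 0 < t, t <= 1, P k.+1 <= P k - alpha * t * (c * dot (d k.+1) (d k.+1)) &
      x k.+2 = x k.+1 + t *: d k.+1] &
  t = 1 \/ 0 < t / eta <= 1 /\ backtrack f g alpha (x k.+1) (d k.+1) (t / eta).
Proof.
move=> hc k; have [/andP[e0 e1] /andP[a0 a1]] := (ABPG_eta hx, ABPG_alpha hx).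
have [gP gC _] := A_convex hA.
have [j [bt nbt xk]] := ABPG_step hx k.+1.
have t0 : 0 < eta ^+ j by rewrite exprn_gt0.
exists (eta ^+ j).
  split => //; first by rewrite exprn_ile1 ?ltW.
  move: nbt; rewrite /backtrack -leNgt -xk !iterate_value.
  have gd := argmin_fin_num gP (@search_direction_min k.+1).
  rewrite -(fineK (iterate_succ_fin_num k)) -(fineK gd) /dual_adde /= lee_fin.
  move=> /le_trans; apply; rewrite lerD2l -mulrN ler_wpM2l//.
  by rewrite mulr_ge0// ltW.
case: j bt {nbt xk t0} => [|j] bt; first by left.
right; rewrite exprSr mulfK ?gt_eqF//; split; last exact: bt.
by rewrite exprn_gt0// exprn_ile1 ?ltW.
Qed.

Lemma iterate_value_nonincreasing k : P k <= P 0.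
Proof.
have [c c0 /iterate_decrease hc] := search_direction_descent.
have /andP[a0 _] := ABPG_alpha hx.
elim: k => // k; have [t [t0 _ dec _] _] := hc k; apply: le_trans.
by apply: le_trans dec _; rewrite gerBl !mulr_ge0 ?dot_ge0// ltW.
Qed.

Lemma iterate_bounded : exists r : R, forall k, `|x k| <= r.
Proof.
have /pinfty_ex_gt0[M M0 hM] := E_level hE (P 0).
(* The level set of [P 0] contains the iterates from index 1 on; the starting point is accounted for
   separately. *)
exists (Num.max M `|x 0|) => -[|k]; rewrite le_max ?lexx ?orbT//.
by rewrite hM//= iterate_value lee_fin iterate_value_nonincreasing.
Qed.

Lemma iterate_value_lb : exists m : R, forall k, m <= P k.
Proof.
have := A_inf hA; set m := ereal_inf _ => mNy.
have le k : (m <= (P k)%:E)%E.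
  rewrite -iterate_value; apply: ereal_inf_lbound.
  by exists (x k.+1) => //; rewrite closureT.
case: m mNy le => [m _ le|_ le|]; last by [].
  by exists m => k; rewrite -lee_fin.
by have := le 0%N.
Qed.

Lemma step_size_lb (c : R) : 0 < c -> descent_rate c ->
  exists2 tau : R, 0 < tau & forall k t, 0 < t ->
    x k.+2 = x k.+1 + t *: d k.+1 ->
    (t = 1 \/
     0 < t / eta <= 1 /\ backtrack f g alpha (x k.+1) (d k.+1) (t / eta)) ->
    tau <= t.
Proof.
move=> c0 hc; have [r xr] := iterate_bounded.
have [/andP[e0 e1] /andP[a0 a1]] := (ABPG_eta hx, ABPG_alpha hx).
have [gP gC _] := A_convex hA.
have r0 : 0 <= r by apply: le_trans (xr 0%N).
(* The radius covers rejected trial points: [x k.+1] has norm at most [r], and the displacement is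
   [eta^-1] times a difference of two iterates. *)
have [M M0 lipf] := lipschitz_on_ball
  (fun B bB => (E_lipschitz hE bB).1) (r + 2 * r / eta).
have re0 : 0 <= r / eta by rewrite divr_ge0// ltW.
pose K := n%:R * M + 1.
have K0 : 0 < K by rewrite ltr_wpDl// mulr_ge0// ltW.
(* Either the unit step is accepted, or [t / eta] is at least the rejection threshold
   [(1 - alpha) * c / K]. The one added in [K] keeps it positive when [n = 0]. *)
exists (Num.min 1 (eta * ((1 - alpha) * c / K))).
  by rewrite lt_min ltr01 mulr_gt0// divr_gt0// mulr_gt0// subr_gt0.
move=> k t t0 xk [->|[t1 bt]]; first by rewrite ge_min lexx.
rewrite ge_min; apply/orP; right.
have gd := argmin_fin_num gP (@search_direction_min k.+1).
have le1 : `|x k.+1| <= r + 2 * r / eta.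
  by apply: le_trans (xr _) _; rewrite lerDl -mulrA mulr_ge0.
have le2 : `|x k.+1 + (t / eta) *: d k.+1| <= r + 2 * r / eta.
  have -> : (t / eta) *: d k.+1 = eta^-1 *: (x k.+2 - x k.+1).
    by rewrite xk addrC addKr scalerA mulrC.
  apply: le_trans (ler_normD _ _) _; apply: lerD => //.
  rewrite normrZ gtr0_norm ?invr_gt0// mulrC ler_pM2r ?invr_gt0//.
  apply: le_trans (ler_normB _ _) _; have := xr k.+1; have := xr k.+2; lra.
have := backtrack_step_lb a1 M0 smooth_fin_num smooth_differentiable lipf gP gC
  (iterate_succ_fin_num k) gd le1 le2 t1 (hc k) bt.
have te0 : 0 < t / eta by rewrite divr_gt0.
move=> h; rewrite -ler_pdivlMl// (mulrC eta^-1) ler_pdivrMr//.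
apply: le_trans h _; rewrite (mulrC (t / eta)) ler_wpM2r ?lerDl ?(ltW te0)//.
Qed.

Lemma enorm_search_direction_cvg0 :
  (fun k => enorm (d k)) @ \oo --> (0 : R).
Proof.
have [c c0 hc] := search_direction_descent.
have /andP[a0 _] := ABPG_alpha hx.
have [m mP] := iterate_value_lb; have [tau tau0 htau] := step_size_lb c0 hc.
have ac0 : 0 < alpha * tau * c by rewrite !mulr_gt0.
have cd : (fun k => dot (d k.+1) (d k.+1)) @ \oo --> (0 : R).
  apply: (sufficient_decrease_cvg0 ac0 _ mP) => [k|k]; first exact: dot_ge0.
  have [t [t0 _ dec xk] ht] := iterate_decrease hc k.
  apply: le_trans dec _; rewrite lerD2l lerN2 -mulrA ler_wpM2r//.
    by rewrite mulr_ge0 ?dot_ge0 ?ltW.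
  by rewrite ler_pM2l// (htau k).
have := continuous_cvg _ (@sqrt_continuous R 0) cd; rewrite sqrtr0 => cs.
by rewrite -cvg_shiftS; exact: cs.
Qed.

Lemma search_direction_cvg0 : d @ \oo --> (0 : 'rV[R]_n).
Proof.
apply: norm_cvg0.
apply: (@squeeze_cvgr _ _ _ _ (cst 0) _ _ _ 0 _ enorm_search_direction_cvg0).
  by near=> k; rewrite normr_ge0 norm_le_enorm.
exact: cvg_cst.
Unshelve. all: by end_near. Qed.

Lemma iterate_range_bounded : bounded_set (range x).
Proof.
have [r xr] := iterate_bounded; exists r; split; first exact: num_real.
by move=> s rs _ [k _ <-]; apply: le_trans (xr k) (ltW rs).
Qed.

(** The condition [j < m j] replaces strict monotonicity of a subsequence: it already forces [m] to
    tend to infinity. *)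
Lemma cluster_index xt : cluster (x @ \oo) xt ->
  exists2 m : nat -> nat, (forall j, j < m j)%N & x \o m @ \oo --> xt.
Proof.
move=> cl.
have ex j : exists k, (j < k)%N /\ `|xt - x k| < j.+1%:R^-1.
  have e0 : 0 < (j.+1%:R^-1 : R) by rewrite invr_gt0.
  have nb : nbhs xt (ball xt (j.+1%:R^-1 : R)) by exact: nbhsx_ballx.
  have xo : (x @ \oo) (x @` [set k | (j < k)%N]).
    by exists j.+1 => // k jk; exists k.
  have [_ [[k jk <-] kb]] := cl _ _ xo nb.
  by exists k; split => //; move: kb; rewrite -ball_normE.
have [m hm] := choice ex; exists m => [j|]; first by have [] := hm j.
apply/cvgrPdist_lt => e e0; near=> j.
have [_ /lt_trans] := hm j; apply.
near: j; exact: near_infty_natSinv_lt (PosNum e0).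
Unshelve. all: by end_near. Qed.

(** If the value at [xt] were [+oo], lower semicontinuity would push Psi above [P 0] near [xt],
    where iterates with values at most [P 0] occur. *)
Lemma cluster_dom xt :
  lower_semicontinuous (f \+ g)%E -> cluster (x @ \oo) xt ->
  (f xt + g xt < +oo)%E.
Proof.
move=> lsc cl; rewrite ltNge; apply/negP; rewrite leye_eq => /eqP fgy.
have [|V Vx hV] := lsc xt (P 0); first by rewrite /= fgy ltry.
have xo : (x @ \oo) (x @` [set k | (0 < k)%N]).
  by exists 1%N => // k k0; exists k.
have [_ [[[//|k] _ <-] /hV]] := cl _ _ xo Vx.
rewrite /= iterate_value lte_fin ltNge => /negP; apply.
exact: iterate_value_nonincreasing.
Qed.

Lemma cluster_stationary xt : lower_semicontinuous (f \+ g)%E ->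
  cluster (x @ \oo) xt -> limiting_subdiff (f \+ g)%E xt 0.
Proof.
move=> lsc cl; have dom := cluster_dom lsc cl.
have [m ltm xm] := cluster_index cl.
have [gP gC _] := A_convex hA.
have ff := smooth_fin_num; have df := smooth_differentiable.
have [_ _ _ fC1] := A_smooth hA; have [_ _ [_ pC2]] := A_kernel hA.
have gxt : g xt \is a fin_num.
  apply: (proper_fin_num gP); move: dom; rewrite -(fineK (ff xt)).
  by case: (g xt) => [s _| |]; rewrite ?ltry ?addey.
have moo : m @ \oo --> \oo.
  move=> A [N _ hN]; exists N => // j /= Nj; apply: hN => /=.
  exact: leq_trans Nj (ltnW (ltm j)).
have dm : d \o m @ \oo --> (0 : 'rV[R]_n).
  exact: cvg_comp moo search_direction_cvg0.
pose u j := x (m j) + d (m j).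
pose H j := hess (fine \o phi) (x (m j)).
(* The subgradient of [g] at [u j] given by optimality: minus the gradient of the smooth part of the
   subproblem. *)
pose v j := - (egrad f (x (m j)) +
  (2 * lambda)^-1 *: (d (m j) *m (H j + (H j)^T))).
have cu : u @ \oo --> xt by rewrite -[xt]addr0; exact: cvgD.
have gradc (y : nat -> 'rV[R]_n) : y @ \oo --> xt ->
    egrad f \o y @ \oo --> egrad f xt.
  by move=> cy; have [_ _ c] := fC1 xt I; exact: (continuous_cvg _ c cy).
have cH : H @ \oo --> hess (fine \o phi) xt.
  by have [_ c] := pC2 xt I; exact: (continuous_cvg _ c xm).
have cv : v @ \oo --> - egrad f xt.
  apply: cvgN; rewrite -[egrad f xt]addr0; apply: cvgD.
    exact: (gradc (x \o m)).
  rewrite -(scaler0 _ (2 * lambda)^-1).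
  by apply: cvgZl_tmp; exact: cvg_mulmx0 cH.
have sub j y : (g (u j) + (dot (v j) (y - u j))%:E <= g y)%E.
  exact: (argmin_subgradient gP gC (@search_direction_min (m j))).
have gu j : g (u j) \is a fin_num.
  exact: (argmin_fin_num gP (@search_direction_min (m j))).
split; first exact: dom.
(* The witnesses sit at [u j] rather than at the iterates, since the subgradient of [g] is known
   there. The Lipschitz constant may depend on [j], a Frechet subgradient being a local notion. *)
exists u, (fun j => egrad f (u j) + v j); split => [j| //| |].
- have r0 : 0 < `|u j| + 1 by rewrite ltr_wpDl.
  have [M M0 lipf] := lipschitz_on_ball
    (fun B bB => (E_lipschitz hE bB).1) (`|u j| + 1).
  by apply: (frechet_subdiff_sum r0 ff df lipf) => //; rewrite ltrDl.
- rewrite /= -(fineK (ff xt)) -(fineK gxt) -EFinD.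
  apply: cvg_EFin.
    by near=> j; rewrite /= fin_numD ff gu.
  apply/cvgrPdist_lt => e e0.
  (* This dominates Psi([u j]) - Psi([xt]), by the subgradient inequality at [u j] tested at [xt];
     lower semicontinuity gives the opposite bound. *)
  have up : (fun j => fine (f (u j)) - fine (f xt) +
      n%:R * (`|v j| * `|xt - u j|)) @ \oo --> (0 : R).
    have -> : 0 = fine (f xt) - fine (f xt) +
        n%:R * (`|- egrad f xt| * `|xt - xt|) :> R.
      by rewrite !subrr normr0 !mulr0 addr0.
    apply: cvgD.
      apply: cvgB; last exact: cvg_cst.
      exact: (continuous_cvg _ (differentiable_continuous (df xt)) cu).
    apply: cvgM; first exact: cvg_cst.
    apply: cvgM; first exact: cvg_norm.
    by apply: cvg_norm; apply: cvgB => //; exact: cvg_cst.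
  have [|V Vx hV] := lsc xt (fine (f xt) + fine (g xt) - e).
    by rewrite /= -(fineK (ff xt)) -(fineK gxt) lte_fin/= ltrBlDr ltrDl.
  near=> j.
  have Vu : V (u j) by near: j; exact: cu.
  have ue : `|0 - (fine (f (u j)) - fine (f xt) +
      n%:R * (`|v j| * `|xt - u j|))| < e.
    by near: j; move/cvgrPdist_lt : up; exact.
  have := hV _ Vu; have := sub j xt; have := norm_dot_le (v j) (xt - u j).
  rewrite /= -(fineK gxt) -(fineK (gu j)) -(fineK (ff (u j))).
  rewrite -EFinD lee_fin lte_fin /=.
  move: ue; rewrite sub0r normrN !ltr_norml !ler_norml.
  move=> /andP[_ h1] /andP[h2 _] h3 h4; apply/andP; split; lra.
- rewrite -(subrr (egrad f xt)); apply: cvgD => //; exact: gradc.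
Unshelve. all: by end_near. Qed.

End abpg_run.

Theorem theorem20 (R : realType) (n : nat) (f g phi : 'rV[R]_n -> \bar R)
    (hA : assumptionA [set: 'rV[R]_n] f g phi)
    (hB : assumptionB [set: 'rV[R]_n] f g phi)
    (hC : assumptionC [set: 'rV[R]_n] f phi)
    (hD : assumptionD [set: 'rV[R]_n] phi)
    (hE : assumptionE f g phi)
    (eta alpha lambda : R) (x d : nat -> 'rV[R]_n)
    (hx : ABPG [set: 'rV[R]_n] f g phi eta alpha lambda x d) :
  [/\ bounded_set (range x),
      (fun k => enorm (d k)) @ \oo --> (0 : R)
    & lower_semicontinuous (f \+ g)%E ->
      forall xt : 'rV[R]_n, cluster (x @ \oo) xt ->
        limiting_subdiff (f \+ g)%E xt 0].
Proof.
split; first exact: (iterate_range_bounded hA hD hE hx).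
  exact: (enorm_search_direction_cvg0 hA hD hE hx).
by move=> lsc xt; exact: (cluster_stationary hA hD hE hx).
Qed.
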